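(* None of the following encoder architectures is RR-hard: the Elman RNN, the GRU, the QRNN, and the LSTM, each in both its saturated and its unsaturated form, as well as (general) counter machines. That is, for each of these architectures there exists a rational series that is not computed by any instance of the architecture.
   Context: WFA: A weighted finite automaton (WFA) $A$ over a finite alphabet $\Sigma$ consists of a finite state set $Q$ and functions $\lambda : Q \to \mathbb{Q}$, $\tau : Q\times\Sigma\times Q \to \mathbb{Q}$, $\rho : Q \to \mathbb{Q}$ (initial, transition, final weights). A path $\pi = q_0 \to_{x_1} q_1 \to_{x_2}\cdots\to_{x_t} q_t$ has score $A[\pi] = \lambda(q_0)\left(\prod_{i=1}^t \tau(q_{i-1},x_i,q_i)\right)\rho(q_t)$, and $A[x] = \sum_\pi A[\pi]$ over all paths producing $x$. A function $\mathbf{f} : \Sigma^* \to \mathbb{Q}^k$ is a rational series if there are WFAs $A_1,\dots,A_k$ with $A_i[x] = f_i(x)$ for all $x$ and $1\le i\le k$. Let $\mathcal R$ be the set of all rational series (over all finite alphabets). An encoder architecture is RR-hard if the set of functions it can compute (over all parameterizations) contains $\mathcal R$. All networks use an embedding $\Sigma\to\mathbb{Q}^{d_x}$, $x_t\mapsto\mathbf x_t$, rational parameters, rational biases (suppressed in notation, allowed in every affine map), and zero initial states; the function computed is $x\mapsto\mathbf h_{|x|}$. Elman RNN: $\mathbf h_t=\tanh(\mathbf W\mathbf x_t+\mathbf U\mathbf h_{t-1})$. GRU: $\mathbf z_t=\sigma(\mathbf W^z\mathbf x_t+\mathbf U^z\mathbf h_{t-1})$, $\mathbf r_t=\sigma(\mathbf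 W^r\mathbf x_t+\mathbf U^r\mathbf h_{t-1})$, $\mathbf u_t=\tanh(\mathbf W^u\mathbf x_t+\mathbf U^u(\mathbf r_t\odot\mathbf h_{t-1}))$, $\mathbf h_t=\mathbf z_t\odot\mathbf h_{t-1}+(1-\mathbf z_t)\odot\mathbf u_t$. LSTM: $\mathbf f_t,\mathbf i_t,\mathbf o_t=\sigma(\mathbf W^{\bullet}\mathbf x_t+\mathbf U^{\bullet}\mathbf h_{t-1})$ with $\bullet=f,i,o$ respectively, $\tilde{\mathbf c}_t=\tanh(\mathbf W^c\mathbf x_t+\mathbf U^c\mathbf h_{t-1})$, $\mathbf c_t=\mathbf f_t\odot\mathbf c_{t-1}+\mathbf i_t\odot\tilde{\mathbf c}_t$, $\mathbf h_t=\mathbf o_t\odot\tanh(\mathbf c_t)$. QRNN (with window length $w$): $\mathbf z_t$, $\mathbf f_t$, $\mathbf i_t$, $\mathbf o_t$ are the rows of $\mathbf Z=\tanh(\mathbf W^z*\mathbf X)$, $\mathbf F=\sigma(\mathbf W^f*\mathbf X)$, $\mathbf I=\sigma(\mathbf W^i*\mathbf X)$, $\mathbf O=\sigma(\mathbf W^o*\mathbf X)$, where $\mathbf X$ is the matrix of input vectors and $*$ is convolution over time with window $w$ (so row $t$ is an affine function of $\mathbf x_{t-w+1},\dots,\mathbf x_t$, zero-padded at the start, followed by the activation); $\mathbf c_t=\mathbf f_t\odot\mathbf c_{t-1}+\mathbf i_t\odot\mathbf z_t$, $\mathbf h_t=\mathbf o_t\odot\mathbf c_t$. Saturation: the saturated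 network is the network in which $\sigma$ is replaced by the step function equal to $1$ on positive and $0$ on negative arguments, and $\tanh$ by the sign function with values in $\{-1,0,1\}$; parameters of a saturated network are such that no argument of a $\sigma$ is exactly $0$ on any input, so all gates lie in $\{0,1\}$. Counter machine (CM): a $k$-counter CM is a tuple $\langle\Sigma,Q,q_0,u,\delta\rangle$ with finite alphabet $\Sigma$, finite state set $Q$, initial state $q_0$, $u:\Sigma\times Q\times\{0,1\}^k\to\{\times 0,-1,+0,+1\}^k$, $\delta:\Sigma\times Q\times\{0,1\}^k\to Q$, where $\circ m$ denotes $n\mapsto n\circ m$. Counters start at $\mathbf 0$; on token $x_t$ from configuration $\langle q_t,\mathbf c_t\rangle\in Q\times\mathbb{Z}^k$: $q_{t+1}=\delta(x_t,q_t,\mathbf 1_{=0}(\mathbf c_t))$, $\mathbf c_{t+1}=u(x_t,q_t,\mathbf 1_{=0}(\mathbf c_t))(\mathbf c_t)$ coordinatewise, with $\mathbf 1_{=0}$ the coordinatewise zero test. It computes the map from $x$ to the counter vector after processing $x$. *)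

(* Defs.v *)
From HB Require Import structures.
From mathcomp Require Import all_boot all_order all_algebra.
From mathcomp Require Import reals sequences exp.

Set Implicit Arguments.
Unset Strict Implicit.
Unset Printing Implicit Defensive.

Import Order.TTheory GRing.Theory Num.Theory.
Local Open Scope ring_scope.

Record wfa (S : finType) := WFA {
  wfa_state : finType;
  wfa_init  : wfa_state -> rat;
  wfa_trans : wfa_state -> S -> wfa_state -> rat;
  wfa_final : wfa_state -> rat
}.

Section WeightedAutomata.
Variables (S : finType) (A : wfa S).

(* A path producing x is its sequence q_0, ..., q_{|x|} of visited states. *)
Definition wfa_path (x : seq S) := {ffun 'I_(size x).+1 -> wfa_state A}.

Definition path_score (x : seq S) (q : wfa_path x) : rat :=
  wfa_init (q ord0)
  * (\prod_(i < size x)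
       wfa_trans (q (widen_ord (leqnSn _) i)) (tnth (in_tuple x) i)
                 (q (lift ord0 i)))
  * wfa_final (q ord_max).

Definition wfa_weight (x : seq S) : rat := \sum_(q : wfa_path x) path_score q.

End WeightedAutomata.

Definition rational_series (S : finType) (k : nat) (f : seq S -> 'cV[rat]_k) :=
  exists A : 'I_k -> wfa S, forall x i, wfa_weight (A i) x = f x i ord0.

(* An encoder architecture over the reals R is identified with the set of
   functions (over all finite alphabets and all output dimensions) that its
   instances compute. *)
Definition architecture (R : realType) :=
  forall (S : finType) (k : nat), (seq S -> 'cV[R]_k) -> Prop.

Definition RR_hard (R : realType) (arch : architecture R) :=
  forall (S : finType) (k : nat) (f : seq S -> 'cV[rat]_k),
    rational_series f -> arch S k (fun x => map_mx ratr (f x)).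

(* act_dom is the set of admissible arguments of act_sigma: an instance whose
   sigma is ever evaluated outside act_dom, on any input, is not allowed. *)
Record activations (R : realType) := Activations {
  act_sigma : R -> R;
  act_dom   : pred R;
  act_tanh  : R -> R
}.

Section Activations.
Variable R : realType.

Definition sigmoid (x : R) : R := (1 + expR (- x))^-1.
Definition tanh (x : R) : R :=
  (expR x - expR (- x)) / (expR x + expR (- x)).
(* The value at 0 is irrelevant, by the choice of act_dom below. *)
Definition heaviside (x : R) : R := if 0 < x then 1 else 0.

Definition unsaturated : activations R :=
  Activations sigmoid predT tanh.
Definition saturated : activations R :=
  Activations heaviside (fun x => x != 0) Num.sg.

End Activations.

(* Rational parameters of an affine map  (x, h) |-> W x + U h + b. *)
Record layer (dx d : nat) := Layer {
  layer_W : 'M[rat]_(d, dx);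
  layer_U : 'M[rat]_d;
  layer_b : 'cV[rat]_d
}.

(* Rational parameters of a convolution of window length w; conv_W j multiplies
   the input vector j steps in the past. *)
Record conv (w dx d : nat) := Conv {
  conv_W : 'I_w -> 'M[rat]_(d, dx);
  conv_b : 'cV[rat]_d
}.

Record gru_params (dx d : nat) :=
  GruParams { gru_z : layer dx d; gru_r : layer dx d; gru_u : layer dx d }.

Record lstm_params (dx d : nat) :=
  LstmParams { lstm_f : layer dx d; lstm_i : layer dx d;
               lstm_o : layer dx d; lstm_c : layer dx d }.

Record qrnn_params (w dx d : nat) :=
  QrnnParams { qrnn_z : conv w dx d; qrnn_f : conv w dx d;
               qrnn_i : conv w dx d; qrnn_o : conv w dx d }.

Section Networks.
Variables (R : realType) (act : activations R) (S : finType) (dx d : nat).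
Variable emb : S -> 'cV[rat]_dx.

Definition had (u v : 'cV[R]_d) : 'cV[R]_d := map2_mx *%R u v.

Definition sigma_vec (v : 'cV[R]_d) : 'cV[R]_d := map_mx (act_sigma act) v.
Definition tanh_vec  (v : 'cV[R]_d) : 'cV[R]_d := map_mx (act_tanh act) v.
Definition in_dom (v : 'cV[R]_d) := forall i, act_dom act (v i ord0).

Definition affine (L : layer dx d) (a : S) (h : 'cV[R]_d) : 'cV[R]_d :=
  map_mx ratr (layer_W L) *m map_mx ratr (emb a)
  + map_mx ratr (layer_U L) *m h + map_mx ratr (layer_b L).

Section Elman.
Variable P : layer dx d.

Definition elman_step (h : 'cV[R]_d) (a : S) := tanh_vec (affine P a h).
Definition elman_run (x : seq S) : 'cV[R]_d := foldl elman_step 0 x.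

End Elman.

Section GRU.
Variable P : gru_params dx d.

Definition gru_step (h : 'cV[R]_d) (a : S) : 'cV[R]_d :=
  let z := sigma_vec (affine (gru_z P) a h) in
  let r := sigma_vec (affine (gru_r P) a h) in
  let u := tanh_vec (affine (gru_u P) a (had r h)) in
  had z h + had (const_mx 1 - z) u.
Definition gru_run (x : seq S) : 'cV[R]_d := foldl gru_step 0 x.

Definition gru_admissible :=
  forall (x : seq S) (a : S),
    in_dom (affine (gru_z P) a (gru_run x)) /\
    in_dom (affine (gru_r P) a (gru_run x)).

End GRU.

Section LSTM.
Variable P : lstm_params dx d.

(* The state is the pair (c_t, h_t). *)
Definition lstm_step (ch : 'cV[R]_d * 'cV[R]_d) (a : S) :=
  let: (c, h) := ch in
  let f := sigma_vec (affine (lstm_f P) a h) in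
  let i := sigma_vec (affine (lstm_i P) a h) in
  let o := sigma_vec (affine (lstm_o P) a h) in
  let c' := had f c + had i (tanh_vec (affine (lstm_c P) a h)) in
  (c', had o (tanh_vec c')).
Definition lstm_run (x : seq S) : 'cV[R]_d := (foldl lstm_step (0, 0) x).2.

Definition lstm_admissible :=
  forall (x : seq S) (a : S),
    [/\ in_dom (affine (lstm_f P) a (lstm_run x)),
        in_dom (affine (lstm_i P) a (lstm_run x)) &
        in_dom (affine (lstm_o P) a (lstm_run x))].

End LSTM.

Section QRNN.
Variables (w : nat) (P : qrnn_params w dx d).

(* Rows are numbered from 0 here: row t is computed from the inputs at
   positions t - w + 1, ..., t, and the terms at negative positions are
   dropped, which amounts to zero padding. *)
Definition conv_row (C : conv w dx d) (x : seq S) (t : nat) : 'cV[R]_d :=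
  \sum_(j < w | (j <= t)%N)
     map_mx ratr (conv_W C j) *m nth 0 [seq map_mx ratr (emb a) | a <- x] (t - j)
  + map_mx ratr (conv_b C).

(* The state c_t after t tokens; token number t + 1 is governed by row t. *)
Fixpoint qrnn_cell (x : seq S) (t : nat) : 'cV[R]_d :=
  if t is t'.+1 then
    had (sigma_vec (conv_row (qrnn_f P) x t')) (qrnn_cell x t')
    + had (sigma_vec (conv_row (qrnn_i P) x t'))
          (tanh_vec (conv_row (qrnn_z P) x t'))
  else 0.

Definition qrnn_hidden (x : seq S) (t : nat) : 'cV[R]_d :=
  if t is t'.+1 then
    had (sigma_vec (conv_row (qrnn_o P) x t')) (qrnn_cell x t)
  else 0.

Definition qrnn_run (x : seq S) : 'cV[R]_d := qrnn_hidden x (size x).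

Definition qrnn_admissible :=
  forall (x : seq S) (t : nat), (t < size x)%N ->
    [/\ in_dom (conv_row (qrnn_f P) x t),
        in_dom (conv_row (qrnn_i P) x t) &
        in_dom (conv_row (qrnn_o P) x t)].

End QRNN.

End Networks.

Section Architectures.
Variables (R : realType) (act : activations R).

Definition elman_rnn : architecture R := fun S k g =>
  exists (dx : nat) (emb : S -> 'cV[rat]_dx) (P : layer dx k),
    forall x, elman_run act emb P x = g x.

Definition gru : architecture R := fun S k g =>
  exists (dx : nat) (emb : S -> 'cV[rat]_dx) (P : gru_params dx k),
    gru_admissible act emb P /\ forall x, gru_run act emb P x = g x.

Definition lstm : architecture R := fun S k g =>
  exists (dx : nat) (emb : S -> 'cV[rat]_dx) (P : lstm_params dx k),
    lstm_admissible act emb P /\ forall x, lstm_run act emb P x = g x.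

(* The window length is a parameter of the instance. *)
Definition qrnn : architecture R := fun S k g =>
  exists (w dx : nat) (emb : S -> 'cV[rat]_dx) (P : qrnn_params w dx k),
    [/\ (0 < w)%N, qrnn_admissible act emb P &
        forall x, qrnn_run act emb P x = g x].

End Architectures.

Inductive counter_op := Reset | Decr | Keep | Incr.

Definition apply_op (o : counter_op) (n : int) : int :=
  match o with Reset => 0 | Decr => n - 1 | Keep => n | Incr => n + 1 end.

Record counter_machine (S : finType) (k : nat) := CounterMachine {
  cm_state  : finType;
  cm_init   : cm_state;
  cm_update : S -> cm_state -> 'cV[bool]_k -> 'cV[counter_op]_k;
  cm_trans  : S -> cm_state -> 'cV[bool]_k -> cm_state
}.

Section CounterMachines.
Variables (S : finType) (k : nat) (M : counter_machine S k).

Definition zero_test (c : 'cV[int]_k) : 'cV[bool]_k := map_mx (eq_op^~ 0) c.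

Definition cm_step (qc : cm_state M * 'cV[int]_k) (a : S) :=
  let: (q, c) := qc in
  (cm_trans a q (zero_test c),
   map2_mx apply_op (cm_update a q (zero_test c)) c).

Definition cm_run (x : seq S) : 'cV[int]_k :=
  (foldl cm_step (cm_init M, 0) x).2.

End CounterMachines.

Definition counter_machines (R : realType) : architecture R := fun S k g =>
  exists M : counter_machine S k, forall x, map_mx intr (cm_run M x) = g x.

Arguments elman_rnn {R} act S k g.
Arguments gru {R} act S k g.
Arguments lstm {R} act S k g.
Arguments qrnn {R} act S k g.
Arguments counter_machines R S k g : clear implicits.

(* Main.v *)
Require Import Defs.
From mathcomp Require Import all_boot all_order all_algebra.
From mathcomp Require Import reals.
From mathcomp Require Import sequences exp.
From mathcomp Require Import lra.

(** Over a one-letter alphabet, a one-state WFA computes [2 ^ |x|].  In every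
    architecture the output grows at most linearly in [|x|]: an Elman RNN, GRU
    or LSTM has outputs in [[-1, 1]] since its activations do, while a QRNN cell
    or a counter moves away from zero by at most 1 at each step. *)

Set Implicit Arguments.
Unset Strict Implicit.
Unset Printing Implicit Defensive.

Import Order.TTheory GRing.Theory Num.Theory.
Local Open Scope ring_scope.

Definition pow2_wfa : wfa unit :=
  @WFA unit unit (fun=> 1) (fun _ _ _ => 2%:R) (fun=> 1).

Lemma pow2_wfa_weight (x : seq unit) : wfa_weight pow2_wfa x = 2%:R ^+ size x.
Proof.
(* The only state is [tt], so the constant path is the only path. *)
rewrite /wfa_weight (bigD1 [ffun=> tt]) //= big1 ?addr0 => [|q]; last first.
  by case/eqP; apply/ffunP => i; rewrite ffunE; case: (q i).
by rewrite /path_score /= mul1r mulr1 prodr_const card_ord.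
Qed.

Section LinearGrowth.
Variable R : realType.

(** The successor lets the constant bound 1 qualify on every word, the empty one included. *)
Definition linear_growth (arch : architecture R) :=
  forall (S : finType) (k : nat) (g : seq S -> 'cV[R]_k), arch S k g ->
  forall x i, `|g x i ord0| <= (size x).+1%:R.

Lemma linear_growth_not_RR_hard (arch : architecture R) :
  linear_growth arch -> ~ RR_hard arch.
Proof.
move=> growth hard.
pose f (x : seq unit) : 'cV[rat]_1 := const_mx (2%:R ^+ size x).
have rat_f : rational_series f.
  by exists (fun=> pow2_wfa) => x i; rewrite pow2_wfa_weight mxE.
(* Length 2 is the least [n] with [2 ^ n > n + 1]: the bound would give [4 <= 3]. *)
have := growth _ _ _ (hard _ _ _ rat_f) [:: tt; tt] ord0.
by rewrite !mxE rmorphXn /= ratr_nat -natrX normr_nat ler_nat.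
Qed.

Definition bounded_activations (act : activations R) :=
  (forall x, 0 <= act_sigma act x <= 1) /\ (forall x, `|act_tanh act x| <= 1).

Lemma saturated_bounded : bounded_activations (saturated R).
Proof.
split=> x /=; first by rewrite /heaviside; case: ifP; rewrite ?lexx ler01.
by rewrite normr_sg lern1 leq_b1.
Qed.

Lemma unsaturated_bounded : bounded_activations (unsaturated R).
Proof.
split=> x /=; have := expR_gt0 (- x).
  rewrite /sigmoid => ?; rewrite invr_ge0 invf_le1; lra.
have := expR_gt0 x; rewrite /tanh => ? ?.
(* Clearing the positive denominator leaves inequalities linear in the positive reals [expR x] and
   [expR (- x)]. *)
rewrite ler_norml ler_pdivlMr ?ler_pdivrMr; lra.
Qed.

Lemma norm_mul_gate (s y b : R) : 0 <= s <= 1 -> `|y| <= b -> `|s * y| <= b.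
Proof.
case/andP=> s_ge0 s_le1 y_le; rewrite normrM ger0_norm //.
by apply: le_trans y_le; rewrite ler_piMl.
Qed.

(** The interval [[-b, b]] is convex; a GRU step mixes the old state and the candidate in this
    way. *)
Lemma norm_convex (s y z b : R) :
  0 <= s <= 1 -> `|y| <= b -> `|z| <= b -> `|s * y + (1 - s) * z| <= b.
Proof. by rewrite !ler_norml => /andP[? ?] /andP[? ?] /andP[? ?]; nra. Qed.

Lemma ler1_succn (n : nat) : 1 <= n.+1%:R :> R.
Proof. by rewrite ler1n. Qed.

Section BoundedActivations.
Variable act : activations R.
Hypothesis act_bounded : bounded_activations act.

Let sigma01 : forall x, 0 <= act_sigma act x <= 1 := act_bounded.1.
Let tanh1 : forall x, `|act_tanh act x| <= 1 := act_bounded.2.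

Lemma elman_linear_growth : linear_growth (elman_rnn act).
Proof.
move=> S k g [dx [emb [P run_g]]] x i; rewrite -run_g.
apply: le_trans (ler1_succn _); case/lastP: x => [|x a].
  by rewrite mxE normr0.
by rewrite /elman_run foldl_rcons mxE.
Qed.

Lemma gru_linear_growth : linear_growth (gru act).
Proof.
move=> S k g [dx [emb [P [_ run_g]]]] x i; rewrite -run_g.
(* The old state reappears in the new one, hence an induction, with the constant bound 1 that convex
   combinations preserve. *)
apply: le_trans (ler1_succn _); elim/last_ind: x => [|x a IHx].
  by rewrite mxE normr0.
rewrite /gru_run foldl_rcons -/(gru_run act emb P x) !mxE.
exact: norm_convex.
Qed.

(** The cell [c] may grow, but the output sees it only through the activation, so the last step
    alone gives the bound. *)
Lemma lstm_linear_growth : linear_growth (lstm act).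
Proof.
move=> S k g [dx [emb [P [_ run_g]]]] x i; rewrite -run_g.
apply: le_trans (ler1_succn _); case/lastP: x => [|x a].
  by rewrite mxE normr0.
rewrite /lstm_run foldl_rcons; case: (foldl _ _ x) => c h /=.
by rewrite !mxE; apply: norm_mul_gate.
Qed.

(** The forget gate does not enlarge the old cell, and the gated input adds at most 1. The word
    stays fixed while [t] varies, as each row is read off the whole word. *)
Lemma qrnn_cell_le (S : finType) (w dx d : nat) (emb : S -> 'cV[rat]_dx)
    (P : qrnn_params w dx d) (x : seq S) (t : nat) (i : 'I_d) :
  `|qrnn_cell act emb P x t i ord0| <= t%:R.
Proof.
elim: t => [|t IHt] /=; first by rewrite mxE normr0.
rewrite !mxE -natr1; apply: le_trans (ler_normD _ _) _.
by apply: lerD; apply: norm_mul_gate.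
Qed.

Lemma qrnn_linear_growth : linear_growth (qrnn act).
Proof.
move=> S k g [w [dx [emb [P [_ _ run_g]]]]] x i; rewrite -run_g.
apply: (@le_trans _ _ (size x)%:R); last by rewrite ler_nat.
rewrite /qrnn_run; case: (size x) => [|t]; first by rewrite mxE normr0.
rewrite /qrnn_hidden !mxE.
(* Expanding the output entry also expanded the cell, so its bound is expanded to match. *)
apply: norm_mul_gate => //; have := qrnn_cell_le emb P x t.+1 i.
by rewrite /= !mxE.
Qed.

End BoundedActivations.

(** A reset can be a long jump, but it lands on 0. *)
Lemma apply_op_norm (o : counter_op) (n : int) : `|apply_op o n| <= `|n| + 1.
Proof.
case: o => /=.
- by rewrite normr0 addr_ge0.
- by apply: le_trans (ler_normB _ _) _; rewrite normr1.
- by rewrite lerDl.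
- by apply: le_trans (ler_normD _ _) _; rewrite normr1.
Qed.

Lemma cm_run_le (S : finType) (k : nat) (M : counter_machine S k) x i :
  `|cm_run M x i ord0| <= (size x)%:Z.
Proof.
elim/last_ind: x => [|x a]; first by rewrite mxE normr0.
rewrite /cm_run foldl_rcons size_rcons; case: (foldl _ _ x) => q c /= IHx.
rewrite mxE; apply: le_trans (apply_op_norm _ _) _.
by rewrite -[(size x).+1]addn1 PoszD lerD2r.
Qed.

Lemma counter_machines_linear_growth : linear_growth (counter_machines R).
Proof.
move=> S k g [M run_g] x i; rewrite -run_g mxE -intr_norm.
apply: (@le_trans _ _ (size x)%:R); last by rewrite ler_nat.
(* Reading the natural number as an integer cast moves the comparison into [int]. *)
by rewrite -[leRHS]/((size x)%:Z%:~R) ler_int cm_run_le.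
Qed.

End LinearGrowth.

Theorem theorem6 (R : realType) :
  [/\ ~ RR_hard (elman_rnn (saturated R)) /\ ~ RR_hard (elman_rnn (unsaturated R)),
      ~ RR_hard (gru (saturated R)) /\ ~ RR_hard (gru (unsaturated R)),
      ~ RR_hard (qrnn (saturated R)) /\ ~ RR_hard (qrnn (unsaturated R)),
      ~ RR_hard (lstm (saturated R)) /\ ~ RR_hard (lstm (unsaturated R)) &
      ~ RR_hard (counter_machines R)].
Proof.
have sat := saturated_bounded R; have unsat := unsaturated_bounded R.
split; [split|split|split|split|]; apply: linear_growth_not_RR_hard.
- exact: elman_linear_growth.
- exact: elman_linear_growth.
- exact: gru_linear_growth.
- exact: gru_linear_growth.
- exact: qrnn_linear_growth.
- exact: qrnn_linear_growth.
- exact: lstm_linear_growth.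
- exact: lstm_linear_growth.
- exact: counter_machines_linear_growth.
Qed.
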